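(* Any dataset $\overline{\mathcal{D}}$ that is anonymized via the mechanism Mech-$(\ell,\delta)$-Diversity (described in the context) satisfies $(\ell,\delta)$-diversity.
   Context: Setting. $\mathcal{Q}$ (quasi-identifiers) and $\mathcal{S}$ (sensitive attributes) are finite sets. A dataset of size $N$ consists of records $(\mathbf{q}_i,s_i)\in\mathcal{Q}\times\mathcal{S}$, $i=1,\dots,N$, drawn i.i.d. from a joint distribution $P_{\mathbf{Q},S}$ with $P_{\mathbf{Q}}(\mathbf{q})>0$ for all $\mathbf{q}\in\mathcal{Q}$ and $P_S(s)>0$ for all $s\in\mathcal{S}$. Let $p_i$ denote the $i$-th largest value in $\{P_S(s):s\in\mathcal{S}\}$. An equivalence class $\overline{\mathbf{q}}$ is a set of quasi-identifiers; distinct equivalence classes are disjoint, and the collection $\overline{\mathcal{Q}}$ of equivalence classes partitions $\mathcal{Q}$. Write $P(\overline{\mathbf{q}},s)=\sum_{\mathbf{q}\in\overline{\mathbf{q}}}P_{\mathbf{Q},S}(\mathbf{q},s)$. The anonymized dataset $\overline{\mathcal{D}}$ is represented by the counts $n^{(\overline{\mathbf{q}})}(s)=|\{i:\mathbf{q}_i\in\overline{\mathbf{q}},\ s_i=s\}|$, $\overline{\mathbf{q}}\in\overline{\mathcal{Q}}$, $s\in\mathcal{S}$. Diversity. $\overline{\mathcal{D}}$ satisfies $\ell$-diversity if $\ell\in\{1,\dots,|\mathcal{S}|\}$ is the largest integer such that for any $\overline{\mathbf{q}}\in\overline{\mathcal{Q}}$ with $\sum_{s\in\mathcal{S}}n^{(\overline{\mathbf{q}})}(s)>0$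 we have $|\{s\in\mathcal{S}:n^{(\overline{\mathbf{q}})}(s)>0\}|\ge\ell$. For fixed $\delta\in(0,1)$, $\overline{\mathcal{D}}$ satisfies $(\ell,\delta)$-diversity if it satisfies $\ell$-diversity in this sense with probability at least $1-\delta$, the probability being over the random sampling of the $N$ records from the underlying distribution. Mech-$(\ell,\delta)$-Diversity. Given an integer $\ell\in(0,|\mathcal{S}|]$ and $\delta\in(0,1)$, a central agency that knows $P_{\mathbf{Q},S}$ exactly chooses $p\in(0,p_\ell]$ and constructs equivalence classes such that $|\{s\in\mathcal{S}:P(\overline{\mathbf{q}},s)\ge p\}|\ge\ell$ for each $\overline{\mathbf{q}}\in\overline{\mathcal{Q}}$. With $$m:=\min\left\{|\mathcal{Q}|,\ \frac{1}{\ell p},\ \frac{\sum_{i=\ell}^{|\mathcal{S}|}p_i}{p}\right\},$$ it broadcasts to the data owners the equivalence classes and the integer $$N=\frac{\ln\left(\frac{m\ell}{\delta}\right)}{\ln\left(\frac{1}{1-p}\right)}.$$ Each data owner waits until it accumulates $N$ samples and then constructs the anonymized dataset $\overline{\mathcal{D}}$ by replacing each quasi-identifier by the equivalence class containing it.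
   Formalization: (ℓ,δ)-diversity is read as: with probability at least 1−δ the largest diversity level is at least ℓ (not exactly ℓ, which is false, e.g. one quasi-identifier, two equally likely values, ℓ=1, p=1/2, δ=1/8); N is rounded up to an integer. *)

(* Defs.v *)
From HB Require Import structures.
From mathcomp Require Import all_boot all_order all_algebra.
From mathcomp Require Import all_classical all_reals all_analysis.

Set Implicit Arguments.
Unset Strict Implicit.
Unset Printing Implicit Defensive.

Import Order.TTheory GRing.Theory Num.Theory.
Local Open Scope ring_scope.

Definition is_pmf (R : realType) (X : finType) (P : X -> R) : Prop :=
  (forall x, 0 <= P x) /\ \sum_x P x = 1.

Definition margQ (R : realType) (Q S : finType) (P : Q * S -> R) (q : Q) : R :=
  \sum_(s : S) P (q, s).

Definition margS (R : realType) (Q S : finType) (P : Q * S -> R) (s : S) : R :=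
  \sum_(q : Q) P (q, s).

Definition class_prob (R : realType) (Q S : finType) (P : Q * S -> R)
    (c : {set Q}) (s : S) : R :=
  \sum_(q in c) P (q, s).

(* The i-th largest value of P_S, with i starting at 1 and values counted with
   multiplicity, so that there are exactly #|S| of them. *)
Definition p_ranked (R : realType) (Q S : finType) (P : Q * S -> R)
    (i : nat) : R :=
  nth 0 (sort (fun x y : R => y <= x) [seq margS P s | s <- enum S]) i.-1.

Definition iid_from (d : measure_display) (T : measurableType d) (R : realType)
    (Pr : probability T R) (I X : finType) (rec : I -> T -> X) (P : X -> R)
    : Prop :=
  [/\ forall i x, measurable (rec i @^-1` [set x])%classic,
      forall i x, Pr (rec i @^-1` [set x])%classic = (P x)%:E
    & forall (J : {set I}) (A : I -> set X),
        Pr (\bigcap_(i in [set` J]) (rec i @^-1` A i))%classic =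
        (\prod_(i in J) Pr (rec i @^-1` A i)%classic)%E].

(* An anonymized dataset is represented by its counts n^(c)(s), as a function
   of the equivalence class c and the sensitive value s. *)
Definition anonymized (Q S : finType) (N : nat) (D : 'I_N -> Q * S)
    (c : {set Q}) (s : S) : nat :=
  #|[set i : 'I_N | ((D i).1 \in c) && ((D i).2 == s)]%SET|.

Definition diversity_cond (Q S : finType) (C : {set {set Q}})
    (n : {set Q} -> S -> nat) (l : nat) : Prop :=
  forall c : {set Q}, c \in C -> (0 < \sum_(s : S) n c s)%N ->
    (l <= #|[set s : S | (0 < n c s)%N]%SET|)%N.

Definition l_diverse (Q S : finType) (C : {set {set Q}})
    (n : {set Q} -> S -> nat) (l : nat) : Prop :=
  [/\ (1 <= l <= #|S|)%N, diversity_cond C n l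
    & forall k, (1 <= k <= #|S|)%N -> diversity_cond C n k -> (k <= l)%N].

(* l_diverse determines l, so it is the diversity level of the dataset.
   The probabilistic guarantee is that this level is at least l: sampling may
   yield more diversity than requested, and asking for level exactly l with
   probability 1 - delta fails already for a uniform two-valued sensitive
   attribute and l = 1. *)
Definition ld_diverse (d : measure_display) (T : measurableType d)
    (R : realType) (Pr : probability T R) (Q S : finType) (C : {set {set Q}})
    (n : T -> {set Q} -> S -> nat) (l : nat) (delta : R) : Prop :=
  ((1 - delta)%:E <=
    Pr [set w : T | exists2 k, (l <= k)%N & l_diverse C (n w) k]%classic)%E.

Definition mech_choice (R : realType) (Q S : finType) (P : Q * S -> R)
    (l : nat) (p : R) (C : {set {set Q}}) : Prop :=
  [/\ 0 < p <= p_ranked P l, finset.partition C [set: Q]%SET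
    & forall c : {set Q}, c \in C ->
        (l <= #|[set s : S | (p <= class_prob P c s)%R]%SET|)%N].

Definition mech_m (R : realType) (Q S : finType) (P : Q * S -> R)
    (l : nat) (p : R) : R :=
  Num.min #|Q|%:R
    (Num.min (1 / (l%:R * p)) ((\sum_(l <= i < #|S|.+1) p_ranked P i) / p)).

(* The quotient of logarithms need not be an integer, so it is rounded up.
   If p = 1 (only possible when #|S| = 1), the conventions 1 / 0 = ln 0 = 0
   make the size 0, which is also what ln (1 / 0) = +oo would give. *)
Definition mech_size (R : realType) (Q S : finType) (P : Q * S -> R)
    (l : nat) (delta p : R) : nat :=
  absz (Num.ceil (ln (mech_m P l p * l%:R / delta) / ln (1 / (1 - p)))).

(* Main.v *)
(* In each equivalence class c pick l heavy values, i.e. values s with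
   P(c, s) >= p.  If every chosen pair (c, s) is hit by some record, then every
   class has at least l distinct values.  A given pair is missed by all N
   records with probability at most (1 - p)^N, so by the union bound diversity
   fails with probability at most |C| l (1 - p)^N.  The number of classes |C| is
   at most m, because the classes are disjoint and nonempty, because the heavy
   cells of all classes have total mass at most 1, and because each class has a
   heavy value of rank at least l; and N is such that m l (1 - p)^N <= delta. *)
Require Import Defs.
From HB Require Import structures.
From mathcomp Require Import all_boot all_order all_algebra.
From mathcomp Require Import all_classical all_reals all_analysis.

Import Order.TTheory GRing.Theory Num.Theory.
Local Open Scope ring_scope.

(** * Finite sums, the union bound and cells of the joint distribution *)

Lemma fsbig_finset (R : Type) (idx : R) (op : Monoid.com_law idx)
    (I : finType) (A : {set I}) (F : I -> R) :
  \big[op/idx]_(i \in [set` A]) F i = \big[op/idx]_(i in A) F i.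
Proof.
rewrite (fsbigE (enum A)) ?enum_uniq //.
- rewrite big_enum_cond /=; apply: eq_bigl => i.
  rewrite (_ : (i \in [set` A]%classic) = (i \in A)) ?andbb //.
  by apply/idP/idP; rewrite in_setE.
- by move=> i /=; rewrite mem_enum.
- by move=> i /= iA; rewrite mem_enum iA.
Qed.

Lemma measure_sub_finset (d : measure_display) (T : measurableType d)
    (R : realType) (mu : {measure set T -> \bar R}) (I : finType)
    (A : {set I}) (E : set T) (F : I -> set T) :
  measurable E -> (forall i, measurable (F i)) ->
  (E `<=` \bigcup_(i in [set` A]) F i)%classic ->
  (mu E <= \sum_(i in A) mu (F i))%E.
Proof.
move=> mE mF EF; rewrite -fsbig_finset.
by apply: content_sub_fsum => //; exact: finite_finset.
Qed.

Lemma subset_of_card (I : finType) (A : {set I}) (k : nat) :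
  (k <= #|A|)%N -> exists2 B : {set I}, B \subset A & #|B| = k.
Proof.
move=> kA; exists [set x in take k (enum A)]%SET.
  by apply/fintype.subsetP => x; rewrite inE => /mem_take; rewrite mem_enum.
rewrite cardsE (card_uniqP (take_uniq _ (enum_uniq _))) size_takel //.
by rewrite -cardE.
Qed.

(** Lets a cell (c, s) be treated as a set of records, the form in which [prob_never_in] computes
    probabilities. *)
Lemma sum_setX_class_prob (R : realType) (Q S : finType) (P : Q * S -> R)
    (c : {set Q}) (s : S) :
  \sum_(x in finset.setX c [set s]%SET) P x = class_prob P c s.
Proof.
rewrite (reindex_onto (fun q => (q, s)) fst) /= /class_prob.
  by apply: eq_bigl => q; rewrite !inE /= !eqxx !andbT.
by move=> [q s'] /=; rewrite !inE /= => /andP[_ /eqP ->].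
Qed.

Lemma class_prob_le1 (R : realType) (Q S : finType) (P : Q * S -> R)
    (c : {set Q}) (s : S) : is_pmf P -> class_prob P c s <= 1.
Proof.
case=> P0 <-; rewrite -sum_setX_class_prob.
rewrite [leRHS](bigID [in finset.setX c [set s]%SET]) /=.
by rewrite lerDl sumr_ge0.
Qed.

(** * Counting the equivalence classes and bounding the sample size *)

Section Classes.
Context {R : realType} {Q S : finType} {P : Q * S -> R}.
Context {l : nat} {p : R} {C : {set {set Q}}}.
Hypothesis P_pmf : is_pmf P.
Hypothesis mech : mech_choice P l p C.
Hypothesis l_gt0 : (0 < l)%N.

Let p_gt0 : 0 < p. Proof. by case: mech => /andP[]. Qed.

Lemma class_prob_ge0 (c : {set Q}) (s : S) : 0 <= class_prob P c s.
Proof. by case: P_pmf => P0 _; apply: sumr_ge0. Qed.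

Lemma sum_class_prob (s : S) : \sum_(c in C) class_prob P c s = margS P s.
Proof.
case: mech => _ /and3P[/eqP covC tC _] _.
rewrite /class_prob -finset.big_trivIset //= covC /margS.
by apply: eq_bigl => q; rewrite inE.
Qed.

Lemma sum_margS : \sum_s margS P s = 1.
Proof.
by case: P_pmf => _ <-; rewrite exchange_big pair_bigA /=; apply: eq_bigr => -[].
Qed.

(** Pigeonhole: at least [l] values are heavy for [c], and fewer than [l] lie outside [A]. *)
Lemma heavy_in (c : {set Q}) (A : {set S}) : c \in C -> (#|~: A| < l)%N ->
  exists2 s, s \in A & p <= class_prob P c s.
Proof.
case: mech => _ _ heavy cC Al.
have: ~~ ([set s | p <= class_prob P c s]%SET \subset ~: A).
  by apply/negP => /subset_leq_card; rewrite leqNgt (leq_trans Al) ?heavy.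
by case/fintype.subsetPn => s; rewrite !inE negbK => ps sA; exists s.
Qed.

Lemma card_classes_le_Q : (#|C| <= #|Q|)%N.
Proof.
case: mech => _ partC _.
rewrite -[#|Q|]cardsT (card_partition partC) -sum1_card.
apply: leq_sum => c cC; rewrite card_gt0.
by apply: contraTneq cC => ->; case/and3P: partC.
Qed.

Lemma card_classes_mul_le1 : #|C|%:R * (l%:R * p) <= 1.
Proof.
(* Expand the 1 into the sum of all P(c, s), classes outermost; it then suffices that each class has
   mass at least [l * p]. *)
rewrite -[leRHS]sum_margS -[leRHS](eq_bigr _ (fun s _ => sum_class_prob s)).
rewrite [leRHS]exchange_big /=.
rewrite mulr_natl -sumr_const; apply: ler_sum => c cC.
case: mech => _ _ /(_ c cC) heavy.
rewrite (bigID [in [set s | p <= class_prob P c s]%SET]) /=.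
apply: ler_wpDr; first by apply: sumr_ge0 => s _; exact: class_prob_ge0.
apply: (@le_trans _ _ (\sum_(s in [set s | p <= class_prob P c s]%SET) p)).
  by rewrite sumr_const -[leRHS]mulr_natl ler_wpM2r ?ler_nat ?ltW.
by apply: ler_sum => s; rewrite inE.
Qed.

(* [l] heavy values of a class cannot all have rank below [l], so each class
   has mass at least [p] on the values of rank at least [l].  Any enumeration
   of [S] would do: that the ranking sorts by probability plays no role. *)
Lemma card_classes_le_tail : (l <= #|S|)%N ->
  #|C|%:R * p <= \sum_(l <= i < #|S|.+1) p_ranked P i.
Proof.
move=> lS.
(* [p_ranked] sorts probabilities, whereas [t] sorts the sensitive values themselves; [sort_map]
   identifies the two, turning the tail sum into a sum over a set of values. *)
pose t := sort (relpre (margS P) (fun x y : R => y <= x)) (enum S).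
have szt : size t = #|S| by rewrite size_sort -cardE.
have ut : uniq t by rewrite sort_uniq enum_uniq.
have -> : \sum_(l <= i < #|S|.+1) p_ranked P i =
    \sum_(s in [set s in drop l.-1 t]%SET) margS P s.
  transitivity (\sum_(s <- drop l.-1 t) margS P s); last first.
    by rewrite big_uniq ?drop_uniq //=; apply: eq_bigl => s; rewrite inE.
  rewrite -(prednK l_gt0) big_add1 /= -(big_map (margS P) xpredT id).
  rewrite (big_addn 0 _ l.-1) [RHS](big_nth 0) size_map size_drop szt.
  apply: eq_bigr => i _; rewrite map_drop nth_drop addnC /p_ranked /=.
  by rewrite sort_map.
rewrite -[leRHS](eq_bigr _ (fun s _ => sum_class_prob s)) [leRHS]exchange_big /=.
rewrite mulr_natl -sumr_const; apply: ler_sum => c cC.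
have [|s sA ps] := heavy_in c [set s in drop l.-1 t]%SET cC.
  (* Exactly [l.-1] values precede rank [l], which is what [heavy_in] requires of the complement. *)
  have := cardsC [set s in drop l.-1 t]%SET.
  rewrite cardsE (card_uniqP (drop_uniq _ ut)) size_drop szt.
  rewrite -[X in _ = X](subnK (leq_trans (leq_pred l) lS)) => /addnI ->.
  by rewrite prednK.
rewrite (bigD1 s) //=; apply: ler_wpDr => //.
by apply: sumr_ge0 => ? _; exact: class_prob_ge0.
Qed.

Lemma card_classes_le_m : (l <= #|S|)%N -> #|C|%:R <= mech_m P l p.
Proof.
move=> lS; rewrite /mech_m !le_min ler_nat card_classes_le_Q /=.
rewrite ler_pdivlMr ?mulr_gt0 ?ltr0n // card_classes_mul_le1 /=.
by rewrite ler_pdivlMr // card_classes_le_tail.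
Qed.

(** An empty [Q] would make the total mass 0 instead of 1, so the partition covers some point. This
    gives m > 0, hence a meaningful logarithm in the sample size. *)
Lemma card_classes_gt0 : (0 < #|C|)%N.
Proof.
have /card_gt0P[q _] : (0 < #|[set: Q]%SET|)%N.
  rewrite cardsT lt0n; apply/eqP => Q0.
  case: P_pmf => _ /eqP; rewrite big_pred0 ?(eq_sym 0) ?oner_eq0 // => -[q s].
  by have := fintype0 q; rewrite Q0 => /(_ erefl).
case: mech => _ /and3P[/eqP covC _ _] _.
have : q \in finset.cover C by rewrite covC inE.
by case/finset.bigcupP => c cC _; apply/card_gt0P; exists c.
Qed.

Lemma threshold_le1 : p <= 1.
Proof.
have /card_gt0P[c cC] := card_classes_gt0.
have [|s _ /le_trans] := heavy_in c [set: S] cC.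
  by rewrite finset.setCT cards0.
by apply; exact: class_prob_le1.
Qed.

Lemma mech_size_bound (delta : R) : (l <= #|S|)%N -> 0 < delta < 1 -> p < 1 ->
  #|C|%:R * l%:R * (1 - p) ^+ mech_size P l delta p <= delta.
Proof.
move=> lS /andP[d0 d1] p1; rewrite /mech_size.
set m := mech_m P l p; set x := ln _ / ln _.
have q0 : 0 < 1 - p by rewrite subr_gt0.
have Cm : #|C|%:R <= m by exact: card_classes_le_m.
have m0 : 0 < m by rewrite (lt_le_trans _ Cm) ?ltr0n ?card_classes_gt0.
have lr0 : 0 < l%:R :> R by rewrite ltr0n.
have ml0 : 0 < m * l%:R / delta by rewrite !mulr_gt0 ?invr_gt0.
have lnq : 0 < ln (1 / (1 - p)).
  by rewrite ln_gt0 // ltr_pdivlMr // mul1r gtrBl.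
(* An integer is at most its absolute value, so the sign of [x] does not have to be determined. *)
have xN : x <= (absz (Num.ceil x))%:R.
  apply: (le_trans (ceil_ge x)).
  by rewrite -[leRHS]/((absz (Num.ceil x))%:Z%:~R) ler_int abszE ler_norm.
apply: (@le_trans _ _ (m * l%:R * (1 - p) ^+ absz (Num.ceil x))).
  by apply: ler_wpM2r; rewrite ?ler_pM2r // exprn_ge0 // ltW.
(* Inverting both sides leaves m l / delta <= (1 / (1 - p)) ^ N; taking logarithms turns this into
   [xN]. *)
rewrite mulrC -ler_pdivlMr ?mulr_gt0 // -invf_div.
rewrite -lef_pV2 ?posrE ?exprn_gt0 ?invr_gt0 // invrK.
rewrite -exprVn -ler_ln ?posrE ?exprn_gt0 ?invr_gt0 // lnXn ?invr_gt0 //.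
by rewrite -[leRHS]mulr_natl -[(1 - p)^-1]div1r -ler_pdivrMr.
Qed.

End Classes.

(** The admissible levels are bounded by [#|S|] and include [l], so a largest one exists and is at
    least [l]. *)
Lemma exists_l_diverse_ge (Q S : finType) (C : {set {set Q}})
    (n : {set Q} -> S -> nat) (l : nat) : (0 < l <= #|S|)%N ->
  diversity_cond C n l -> exists2 k, (l <= k)%N & l_diverse C n k.
Proof.
move=> lS nl; pose A k := (1 <= k <= #|S|)%N && `[< diversity_cond C n k >].
have exA : exists k, A k by exists l; rewrite /A lS; apply/asboolP.
have ubA k : A k -> (k <= #|S|)%N by case/andP => /andP[].
case: (ex_maxnP exA ubA) => k /andP[kS /asboolP nk] kmax.
exists k; first by apply: kmax; rewrite /A lS; apply/asboolP.
by split=> // j jS nj; apply: kmax; rewrite /A jS; apply/asboolP.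
Qed.

(** * Events determined by an i.i.d. sample *)

Section Sampling.
Context {d : measure_display} {T : measurableType d} {R : realType}.
Context {Pr : probability T R} {I X : finType} {rec : I -> T -> X} {P : X -> R}.
Hypothesis rec_iid : iid_from Pr rec P.

(** There are finitely many possible samples, so any event about the sample is a finite union of
    events fixing every record. *)
Lemma measurable_sample (E : (I -> X) -> Prop) :
  measurable [set w | E (fun i => rec i w)]%classic.
Proof.
case: rec_iid => mrec _ _.
have -> : [set w | E (fun i => rec i w)]%classic =
  (\bigcup_(f in [set f : {ffun I -> X} | E f])
     \bigcap_(i in [set: I]) (rec i @^-1` [set f i]))%classic.
  apply/seteqP; split => w /=.
    move=> Ew; exists [ffun i => rec i w].
      rewrite /= (_ : fun_of_fin _ = fun i => rec i w) //.
      by apply/funext => i; rewrite ffunE.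
    by move=> i _ /=; rewrite ffunE.
  case=> f /= Ef fw; rewrite (_ : (fun i => rec i w) = f) //.
  by apply/funext => i; exact: fw.
apply: fin_bigcup_measurable => // f _.
by apply: fin_bigcap_measurable.
Qed.

Lemma prob_record_in (i : I) (A : {set X}) :
  Pr (rec i @^-1` [set` A])%classic = (\sum_(x in A) P x)%:E.
Proof.
case: rec_iid => mrec prec _.
have -> : (rec i @^-1` [set` A] = \bigcup_(x in [set` A]) (rec i @^-1` [set x]))%classic.
  apply/seteqP; split => w /=; first by move=> wA; exists (rec i w).
  by case=> x /= xA ->.
rewrite measure_fin_bigcup //; first last.
- by move=> x y _ _ [w [/= -> ->]].
rewrite -sumEFin -fsbig_finset.
by apply: eq_fsbigr => x _; exact: prec.
Qed.

(** Apply independence to the events that record [i] lies in the complement of [A]. *)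
Lemma prob_never_in (A : {set X}) : \sum_x P x = 1 ->
  Pr [set w | forall i, rec i w \notin A]%classic =
  ((1 - \sum_(x in A) P x) ^+ #|I|)%:E.
Proof.
move=> P1.
have -> : ([set w | forall i, rec i w \notin A] =
    \bigcap_(i in [set` [set: I]%SET]) (rec i @^-1` [set` ~: A]))%classic.
  apply/seteqP; split => w /= Aw i; first by move=> _; rewrite /= inE.
  by have := Aw i; rewrite /= !inE; apply.
case: (rec_iid) => _ _ ->.
have -> : 1 - \sum_(x in A) P x = \sum_(x in ~: A) P x.
  rewrite -P1 (bigID [in A]) /= addrAC subrr add0r.
  by apply: eq_bigl => x; rewrite inE.
rewrite (eq_bigr _ (fun i _ => prob_record_in i (~: A)%SET)).
by rewrite prodEFin prodr_const cardsT.
Qed.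

End Sampling.

Lemma diversity_cond_of_hits (Q S : finType) (C : {set {set Q}}) (N : nat)
    (D : 'I_N -> Q * S) (l : nat) (L : {set Q} -> {set S}) :
  (forall c, c \in C -> #|L c| = l) ->
  (forall c s, c \in C -> s \in L c -> exists2 i, (D i).1 \in c & (D i).2 = s) ->
  diversity_cond C (anonymized D) l.
Proof.
move=> Ll hit c cC _; rewrite -(Ll c cC).
apply/subset_leq_card/fintype.subsetP => s sL; rewrite inE.
have [i iQ iS] := hit c s cC sL.
by apply/card_gt0P; exists i; rewrite inE iQ iS eqxx.
Qed.

Theorem theorem4p4 (R : realType) (Q S : finType) (P : Q * S -> R)
  (P_pmf : is_pmf P)
  (PQ_gt0 : forall q : Q, 0 < margQ P q)
  (PS_gt0 : forall s : S, 0 < margS P s)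
  (l : nat) (l_range : (0 < l <= #|S|)%N)
  (delta : R) (delta_range : 0 < delta < 1)
  (p : R) (C : {set {set Q}}) (mech : mech_choice P l p C)
  (d : measure_display) (T : measurableType d) (Pr : probability T R)
  (rec : 'I_(mech_size P l delta p) -> T -> Q * S)
  (rec_iid : iid_from Pr rec P) :
  ld_diverse Pr C (fun w : T => anonymized (fun i => rec i w)) l delta.
Proof.
have [l0 lS] := andP l_range.
have [p1 | p1] := ltP p 1; last first.
  (* Junk values [1 / 0 = ln 0 = 0] make the sample empty when [p = 1]. *)
  have size0 : mech_size P l delta p = 0%N.
    have -> : p = 1 by apply/le_anti; rewrite p1 (threshold_le1 P_pmf mech l0).
    by rewrite /mech_size subrr invr0 mulr0 [ln 0]ln0 // invr0 mulr0 ceil0.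
  rewrite /ld_diverse [X in Pr X](_ : _ = setT) ?probability_setT.
    by rewrite lee_fin gerBl ltW; case/andP: delta_range.
  (* Without records all counts vanish, so the condition, which concerns nonempty classes only,
     holds vacuously. *)
  apply/seteqP; split=> // w _; apply: exists_l_diverse_ge => // c _.
  rewrite big1 // => s _; apply/eqP; rewrite cards_eq0; apply/eqP/setP => i.
  by have := ltn_ord i; rewrite [X in (_ < X)%N]size0.
(* Exactly [l] heavy values are kept per class, so that [K] below has exactly [#|C| * l] cells. *)
have /choice[L LP] : forall c : {set Q}, exists B : {set S}, c \in C ->
    B \subset [set s | p <= class_prob P c s]%SET /\ #|B| = l.
  move=> c; have [cC|] := boolP (c \in C); last by exists finset.set0.
  by case: mech => _ _ /(_ c cC) /subset_of_card[B BS Bl]; exists B.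
pose E := [set w : T | exists2 k, (l <= k)%N &
  l_diverse C (anonymized (fun i => rec i w)) k]%classic.
pose K := [set cs : {set Q} * S | (cs.1 \in C) && (cs.2 \in L cs.1)]%SET.
pose miss (cs : {set Q} * S) :=
  [set w : T | forall i, rec i w \notin finset.setX cs.1 [set cs.2]%SET]%classic.
have mE : measurable E.
  exact: (measurable_sample rec_iid
    (fun D => exists2 k, (l <= k)%N & l_diverse C (anonymized D) k)).
have mmiss cs : measurable (miss cs).
  exact: (measurable_sample rec_iid
    (fun D => forall i, D i \notin finset.setX cs.1 [set cs.2]%SET)).
have EK : (~` E `<=` \bigcup_(cs in [set` K]) miss cs)%classic.
  move=> w; apply: contra_notP => nmiss.
  apply: exists_l_diverse_ge => //.
  apply: (@diversity_cond_of_hits _ _ _ _ _ _ L) => [c /LP[]//|c s cC sL].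
  apply: contrapT => nhit; apply: nmiss; exists (c, s); first by rewrite /= inE /= cC.
  move=> i; rewrite !inE /=; apply/andP => -[iQ /eqP iS].
  by apply: nhit; exists i.
have bad : (Pr (~` E)%classic <= delta%:E)%E.
  apply: (le_trans (measure_sub_finset _ _ _ _ _ _ _ _ (measurableC mE) mmiss EK)).
  apply: (@le_trans _ _ (\sum_(cs in K) ((1 - p) ^+ mech_size P l delta p)%:E)%E).
    apply: lee_sum => -[c s]; rewrite inE /= => /andP[cC sL].
    rewrite /miss (prob_never_in rec_iid); last by case: P_pmf.
    rewrite card_ord sum_setX_class_prob lee_fin /=.
    have [/fintype.subsetP/(_ s sL)] := LP c cC; rewrite inE => ps _.
    (* A heavy cell is missed by one record with probability 1 - P(c, s), at most 1 - p. *)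
    apply: lerXn2r; rewrite ?nnegrE ?lerB ?subr_ge0 ?(ltW p1) //.
    exact: class_prob_le1.
  rewrite sumEFin sumr_const lee_fin -mulr_natl.
  suff -> : #|K| = (#|C| * l)%N by rewrite natrM; exact: mech_size_bound.
  rewrite -sum1_card -sum_nat_const.
  rewrite (eq_bigl (fun cs => (cs.1 \in C) && (cs.2 \in L cs.1))); last first.
    by move=> cs; rewrite inE.
  rewrite -(pair_big_dep [in C] (fun c s => s \in L c) (fun _ _ => 1%N)) /=.
  by apply: eq_bigr => c /LP[_ <-]; rewrite sum1_card.
rewrite /ld_diverse -/E -[E]setCK probability_setC; last exact: measurableC.
by rewrite EFinB; exact: leeB.
Qed.
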